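(* For all non-negative integers $x, y$, the $\mathcal{G}$-value of the Delete Nim position $(x,y)$ is $$\mathcal{G}((x,y)) = v_2\big((x \vee y)+1\big),$$ where $x \vee y$ is the bitwise OR of $x$ and $y$ and $v_2$ is the $2$-adic valuation.
   Context: Delete Nim is the following impartial two-player game in normal play (the player who makes the last move wins). A position consists of two heaps of stones; the position with heaps of $x$ and $y$ stones ($x,y$ non-negative integers, heaps may be empty) is denoted $(x,y)$, and $(x,y)$ and $(y,x)$ denote the same position. On a move, the player chooses one of the heaps (which must contain at least one stone) and deletes the other heap; then she takes away $1$ stone from the chosen heap and optionally splits the rest into two heaps. Equivalently, the options of $(x,y)$ are exactly the positions $(x',y')$ with $x',y'$ non-negative integers such that $x'+y'=x-1$ or $x'+y'=y-1$ (not splitting corresponds to one of $x',y'$ being $0$). The only position without options is $(0,0)$. Write $g \rightarrow g'$ if $g'$ is an option of $g$ (a position reachable from $g$ in one move). Let $\mathbb{N}$ be the set of non-negative integers. For a proper subset $S \subsetneq \mathbb{N}$, $\mathrm{mex}(S)=\min(\mathbb{N}\setminus S)$. The $\mathcal{G}$-value of a position is defined recursively by $\mathcal{G}(g)=\mathrm{mex}(\{\mathcal{G}(g') \mid g\rightarrow g'\})$. The operation $\vee$ is the usual OR operation on binary expansions (e.g. $3\vee 5 = 11_2\vee 101_2=111_2=7$). For a prime $p$, $v_p(n)=\max\{v\in\mathbb{N} : p^v\mid n\}$ if $n\neq 0$, and $v_p(0)=\infty$. *)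

(* Defs.v *)
From mathcomp Require Import all_boot.
From mathcomp Require Import zify.

Set Implicit Arguments.
Unset Strict Implicit.
Unset Printing Implicit Defensive.

(* Positions are ordered pairs standing for unordered ones: the options do not
   depend on the order of the heaps ([mem_options]), and the G-value is
   symmetric ([gvalueC]). *)
Definition position := (nat * nat)%type.

Definition heap_options (n : nat) : seq position :=
  if n is m.+1 then [seq (i, m - i) | i <- iota 0 m.+1] else [::].

Definition options (g : position) : seq position :=
  heap_options g.1 ++ heap_options g.2.

Lemma mem_heap_options (n : nat) (g : position) :
  (g \in heap_options n) = ((g.1 + g.2).+1 == n).
Proof.
case: n => [|m] //; case: g => a b.
apply/mapP/eqP => [[i] | [<-]] /=.
  by rewrite -/(iota 0 m.+1) mem_iota => /andP[_ lim] [-> ->]; lia.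
exists a; first by rewrite -/(iota 0 (a + b).+1) mem_iota; lia.
by rewrite addKn.
Qed.

Lemma mem_options (g g' : position) :
  (g' \in options g) =
    ((g'.1 + g'.2).+1 == g.1) || ((g'.1 + g'.2).+1 == g.2).
Proof. by rewrite mem_cat !mem_heap_options. Qed.

Lemma ex_notin (s : seq nat) : exists n, n \notin s.
Proof.
exists (\max_(i <- s) i).+1; apply/negP => max_s.
by have := @leq_bigmax_seq nat s xpredT id _ max_s isT; rewrite ltnn.
Qed.

(* A sequence represents the finite set of its elements. *)
Definition mex (s : seq nat) : nat := ex_minn (ex_notin s).

Lemma eq_mex (s t : seq nat) : s =i t -> mex s = mex t.
Proof. by move=> st; apply: eq_ex_minn => n; rewrite st. Qed.

(* The recursion is on a bound for the length of a play; [gvalueE] is the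
   defining recursive equation. *)
Fixpoint gvalue_rec (k : nat) (g : position) : nat :=
  if k is k'.+1 then mex [seq gvalue_rec k' g' | g' <- options g] else 0.

Definition gvalue (g : position) : nat := gvalue_rec (g.1 + g.2).+1 g.

Lemma gvalue_rec_bound (k l : nat) (g : position) :
  g.1 + g.2 < k -> g.1 + g.2 < l -> gvalue_rec k g = gvalue_rec l g.
Proof.
elim: k l g => [|k IHk] [|l] g //= gk gl.
congr mex; apply/eq_in_map => g'; rewrite mem_options => g'P.
by apply: IHk; move: gk gl g'P; case: g g' => [a b] [c d] /=; lia.
Qed.

Lemma gvalueE (g : position) :
  gvalue g = mex [seq gvalue g' | g' <- options g].
Proof.
rewrite {1}/gvalue /=; congr mex; apply/eq_in_map => g'.
rewrite mem_options => g'P; apply: gvalue_rec_bound => //.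
by move: g'P; case: g g' => [a b] [c d] /=; lia.
Qed.

Lemma gvalueC (x y : nat) : gvalue (x, y) = gvalue (y, x).
Proof.
rewrite [LHS]gvalueE [RHS]gvalueE; apply/eq_mex/eq_mem_map => g.
by rewrite !mem_options orbC.
Qed.

(* Main.v *)
Require Import Defs.
From mathcomp Require Import all_boot.
From Stdlib Require Import PeanoNat.
From mathcomp Require Import zify.

(** Adding one to [n] carries through its trailing ones, so [logn 2 (n + 1)]
    is their number, that is, the least [k] such that bit [k] of [n] is zero:
    it is the mex of the set of positions of the ones of [n]. The ones of
    [lor x y] are the ones of [x] together with the ones of [y], and the
    options of [(x, y)] are the options of the heap [x] together with those of
    the heap [y]. So, by induction, it is enough to look at a single heap, and
    to see that the values [logn 2 (lor a b + 1)] of the pairs with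
    [a + b + 1 = n] are exactly the positions of the ones of [n].

    In one direction ([testbit_split]), if [lor a b] has [k] trailing ones,
    then the lowest [k] bits of [a] and of [b], as numbers, add up to at least
    [2 ^ k - 1] and at most [2 * (2 ^ k - 1)], and bit [k] is zero in both; so
    adding one more to the sum gives a number whose bit [k] is one. In the
    other direction ([split_testbit]), if [n = 2 ^ k.+1 * q + 2 ^ k + r] with
    [r < 2 ^ k], then [a = 2 ^ k - 1] and [b = 2 ^ k.+1 * q + r] will do. Both
    are proved by peeling off the lowest bits, where the arithmetic is that of
    parities and halves. *)

Lemma oddE n : Nat.odd n = odd n.
Proof.
by elim/ltn_ind: n => -[|[|n]] // IHn; rewrite /= negbK -IHn.
Qed.

Lemma div2E n : Nat.div2 n = n./2.
Proof. by elim/ltn_ind: n => -[|[|n]] // IHn /=; rewrite IHn. Qed.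

Lemma testbit0 n : Nat.testbit n 0 = odd n.
Proof. exact: oddE. Qed.

Lemma testbitS n k : Nat.testbit n k.+1 = Nat.testbit n./2 k.
Proof. by rewrite /= div2E. Qed.

Lemma odd_lor a b : odd (Nat.lor a b) = odd a || odd b.
Proof. by rewrite -!testbit0 Nat.lor_spec. Qed.

Lemma half_lor a b : (Nat.lor a b)./2 = Nat.lor a./2 b./2.
Proof. by rewrite -!div2E; exact: (Nat.shiftr_lor a b 1). Qed.

Lemma logn2S n : logn 2 n.+1 = if odd n then (logn 2 n./2.+1).+1 else 0.
Proof.
case: ifP => n_odd; last by apply: logn_coprime; rewrite coprime2n /= n_odd.
have -> : n.+1 = 2 * n./2.+1 by lia.
by rewrite lognM // logn_prime.
Qed.

Lemma testbit_logn2S n : Nat.testbit n (logn 2 n.+1) = false.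
Proof.
elim/ltn_ind: n => n IHn; rewrite logn2S; case: ifP => n_odd.
  by rewrite testbitS; apply: IHn; lia.
by rewrite testbit0.
Qed.

Lemma testbit_lt_logn2S n k : k < logn 2 n.+1 -> Nat.testbit n k.
Proof.
elim: k n => [|k IHk] n; rewrite logn2S; case: ifP => // n_odd lt_k.
  by rewrite testbit0.
by rewrite testbitS; apply: IHk.
Qed.

(** If [a] or [b] is odd, then [(a + b + 1)./2 = a./2 + b./2 + 1], whether the
    other is odd or not: the shape of the sum survives dropping the lowest
    bits, until both numbers are even and the sum is odd. *)
Lemma testbit_split a b :
  Nat.testbit (a + b).+1 (logn 2 (Nat.lor a b).+1).
Proof.
move: {-1}(logn 2 _) (erefl (logn 2 (Nat.lor a b).+1)) => k.
elim: k a b => [|k IHk] a b; rewrite logn2S odd_lor half_lor.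
  by case: ifP => // ab_even _; rewrite testbit0; lia.
case: ifP => // ab_odd [/IHk]; rewrite testbitS.
by have -> : (a + b).+1./2 = (a./2 + b./2).+1 by lia.
Qed.

Lemma split_testbit n k : Nat.testbit n k ->
  exists a b, (a + b).+1 = n /\ logn 2 (Nat.lor a b).+1 = k.
Proof.
elim: k n => [|k IHk] n.
  rewrite testbit0 => n_odd; exists 0, n.-1; split; first by lia.
  by rewrite logn2S odd_lor /=; case: ifP => //; lia.
rewrite testbitS => /IHk[a [b [ab_n ab_k]]].
(* The new lowest bits must not both be zero, and 2a + 1 and 2b + odd n add up
   to n - 1. *)
exists a.*2.+1, (b.*2 + odd n); split; first by lia.
rewrite logn2S odd_lor half_lor /= odd_double /=.
have -> : uphalf a.*2 = a by lia.
have -> : (b.*2 + odd n)./2 = b by lia.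
by rewrite ab_k.
Qed.

Lemma mex_unique (s : seq nat) m :
  m \notin s -> (forall k, k < m -> k \in s) -> mex s = m.
Proof.
rewrite /mex => m_notin lt_in; case: ex_minnP => n n_notin n_min.
apply/eqP; rewrite eqn_leq n_min //= leqNgt; apply/negP => /lt_in.
by rewrite (negbTE n_notin).
Qed.

Theorem theorem4 (x y : nat) :
  gvalue (x, y) = logn 2 (Nat.lor x y + 1).
Proof.
have [n] := ubnP (x + y); elim: n x y => // n IHn x y lt_n.
rewrite gvalueE addn1.
have gvalue_option a b : (a, b) \in options (x, y) ->
    gvalue (a, b) = logn 2 (Nat.lor a b).+1.
  rewrite mem_options /= => ab_opt; rewrite IHn ?addn1 //.
  by move: lt_n ab_opt; lia.
apply: mex_unique => [|k /testbit_lt_logn2S].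
  apply/mapP => -[[a b] ab_opt]; rewrite (gvalue_option _ _ ab_opt) => eq_log.
  have := testbit_logn2S (Nat.lor x y); rewrite eq_log Nat.lor_spec.
  by move: ab_opt; rewrite mem_options /= =>
    /orP[] /eqP <-; rewrite testbit_split ?orbT.
rewrite Nat.lor_spec => xy_k.
suff [a [b [ab_opt <-]]] : exists a b,
    (a, b) \in options (x, y) /\ logn 2 (Nat.lor a b).+1 = k.
  by apply/mapP; exists (a, b); rewrite ?gvalue_option.
by case/orP: xy_k => /split_testbit[a [b [ab_n ab_k]]]; exists a, b;
  rewrite mem_options /= ab_n eqxx ?orbT.
Qed.
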